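(* Let $\rho$ be a polymatroid on a finite set $E$ and let $A\subseteq E$. Let $\mathcal{R}_\rho(A)=\{B\in\mathcal{Z}_\rho : \rho(A)=\rho(B)+\sum_{i\in A-B}\rho(\{i\})\}$. Then (I) $\mathrm{cl}_\rho(\mathrm{cy}_\rho(A))$ and $\mathrm{cy}_\rho(\mathrm{cl}_\rho(A))$ are in $\mathcal{R}_\rho(A)$; (II) if $B\in\mathcal{R}_\rho(A)$, then $\mathrm{cl}_\rho(\mathrm{cy}_\rho(A))\subseteq B\subseteq\mathrm{cy}_\rho(\mathrm{cl}_\rho(A))$; (III) $\mathcal{R}_\rho(A)$ is a sublattice of $\mathcal{Z}_\rho$, i.e., for $B,B'\in\mathcal{R}_\rho(A)$ both $B\wedge B'=\mathrm{cy}_\rho(B\cap B')$ and $B\vee B'=\mathrm{cl}_\rho(B\cup B')$ lie in $\mathcal{R}_\rho(A)$; (IV) if $B,B'\in\mathcal{R}_\rho(A)$, then $\rho(B)+\rho(B')=\rho(B\cup B')+\rho(B\cap B')$.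
   Context: A polymatroid on a finite set $E$ is a function $\rho:2^E\to\mathbb{R}$ with $\rho(\emptyset)=0$, $\rho(A)\le\rho(B)$ whenever $A\subseteq B\subseteq E$, and $\rho(A\cup B)+\rho(A\cap B)\le\rho(A)+\rho(B)$ for all $A,B\subseteq E$. We write $\rho(i)$ for $\rho(\{i\})$. A set $A\subseteq E$ is a flat if $\rho(A\cup\{i\})>\rho(A)$ for all $i\in E-A$; $A$ is cyclic if $\rho(A)<\rho(A-\{i\})+\rho(i)$ for all $i\in A$ with $\rho(i)>0$; a cyclic flat is a set that is both. $\mathcal{Z}_\rho$ denotes the set of cyclic flats, ordered by inclusion. For $A\subseteq E$, $\mathrm{cl}_\rho(A)$ is the intersection of all flats containing $A$, and $\mathrm{cy}_\rho(A)$ is the union of all cyclic sets contained in $A$. ($\mathcal{Z}_\rho$ is a lattice with meet $B\wedge B'=\mathrm{cy}_\rho(B\cap B')$ and join $B\vee B'=\mathrm{cl}_\rho(B\cup B')$.) *)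

(* Defs.v *)
From mathcomp Require Import all_boot all_order all_algebra.
From mathcomp Require Import reals.

Set Implicit Arguments.
Unset Strict Implicit.
Unset Printing Implicit Defensive.

Import Order.TTheory GRing.Theory Num.Theory.
Local Open Scope ring_scope.

Definition polymatroid (R : realType) (E : finType) (rho : {set E} -> R) : Prop :=
  [/\ rho set0 = 0,
      forall A B : {set E}, A \subset B -> rho A <= rho B
    & forall A B : {set E}, rho (A :|: B) + rho (A :&: B) <= rho A + rho B].

Definition flat (R : realType) (E : finType) (rho : {set E} -> R)
    (A : {set E}) : bool :=
  [forall i : E, (i \notin A) ==> (rho A < rho (A :|: [set i]))].

(* Elements i with rho {i} = 0 impose no condition. *)
Definition cyclic_set (R : realType) (E : finType) (rho : {set E} -> R)
    (A : {set E}) : bool :=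
  [forall i in A, (0 < rho [set i]) ==> (rho A < rho (A :\ i) + rho [set i])].

Definition cyclic_flats (R : realType) (E : finType) (rho : {set E} -> R) :
    {set {set E}} :=
  [set A : {set E} | flat rho A && cyclic_set rho A].

Definition cl (R : realType) (E : finType) (rho : {set E} -> R)
    (A : {set E}) : {set E} :=
  \bigcap_(F : {set E} | flat rho F && (A \subset F)) F.

Definition cy (R : realType) (E : finType) (rho : {set E} -> R)
    (A : {set E}) : {set E} :=
  \bigcup_(C : {set E} | cyclic_set rho C && (C \subset A)) C.

Definition Rset (R : realType) (E : finType) (rho : {set E} -> R)
    (A : {set E}) : {set {set E}} :=
  [set B in cyclic_flats rho |
    rho A == rho B + \sum_(i in A :\: B) rho [set i]].

(* Main.v *)
Require Import Defs.
From mathcomp Require Import all_boot all_order all_algebra.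
From mathcomp Require Import reals lra.

Set Implicit Arguments.
Unset Strict Implicit.
Unset Printing Implicit Defensive.

Import Order.TTheory GRing.Theory Num.Theory.
Local Open Scope ring_scope.

(** Put [f B = rho B + \sum_(i in A - B) rho {i}]. Then [f] is submodular and
    [rho A <= rho (A :|: B) <= f B], so [Rset rho A] consists of the cyclic
    flats at which [f] attains the lower bound [rho A]. Neither [cl] nor [cy]
    increases [f], and [f A = rho A]; this gives (I). Submodularity makes the
    minimizers of [f] closed under union and intersection, with equality in
    the submodular inequality; this gives (III) and (IV). *)

Definition weight (R : realType) (E : finType) (rho : {set E} -> R)
    (S : {set E}) : R := \sum_(i in S) rho [set i].

(** The function [f] of the overview, taken with [A] fixed. *)
Definition rank_bound (R : realType) (E : finType) (rho : {set E} -> R)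
    (A B : {set E}) : R := rho B + weight rho (A :\: B).

Lemma rho_ge0 (R : realType) (E : finType) (rho : {set E} -> R) (S : {set E}) :
  polymatroid rho -> 0 <= rho S.
Proof. by case=> r0 mono _; rewrite -r0; apply: mono; apply: sub0set. Qed.

(** * Weights *)

Lemma weight_subU (R : realType) (E : finType) (rho : {set E} -> R)
    (S X Y : {set E}) :
  polymatroid rho -> S \subset X :|: Y ->
  weight rho S <= weight rho X + weight rho Y.
Proof.
move=> hrho sS; rewrite /weight !(big_mkcond (fun i => i \in _)) -big_split /=.
apply: ler_sum => i _; move/subsetP: sS => /(_ i); rewrite inE.
have := rho_ge0 [set i] hrho.
by case: (i \in S) => //; case: (i \in X); case: (i \in Y) => //= ? H;
  try (by have := H isT); lra.
Qed.

Lemma weight_sub (R : realType) (E : finType) (rho : {set E} -> R)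
    (S X : {set E}) :
  polymatroid rho -> S \subset X -> weight rho S <= weight rho X.
Proof.
move=> hrho sS; have := @weight_subU _ _ rho S X set0 hrho.
by rewrite setU0 /weight big_set0 addr0; apply.
Qed.

Lemma weight_diffD1 (R : realType) (E : finType) (rho : {set E} -> R)
    (S X : {set E}) (i : E) :
  i \in S :\: X ->
  weight rho (S :\: X) = rho [set i] + weight rho (S :\: (i |: X)).
Proof.
move=> iS; rewrite /weight (big_setD1 i iS) /=; congr (_ + _).
by apply: eq_bigl => j; rewrite !inE negb_or andbA.
Qed.

Lemma weight_diff_modular (R : realType) (E : finType) (rho : {set E} -> R)
    (A B B' : {set E}) :
  weight rho (A :\: (B :|: B')) + weight rho (A :\: (B :&: B')) =
  weight rho (A :\: B) + weight rho (A :\: B').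
Proof.
rewrite /weight !(big_mkcond (fun i => i \in _)) -!big_split /=.
apply: eq_bigr => i _; rewrite !inE.
by case: (i \in A); case: (i \in B); case: (i \in B') => /=; lra.
Qed.

(** * Rank inequalities *)

Lemma rho_leU_weight (R : realType) (E : finType) (rho : {set E} -> R)
    (A S : {set E}) :
  polymatroid rho -> rho (A :|: S) <= rho A + weight rho (S :\: A).
Proof.
move=> hrho; have [r0 _ sub] := hrho.
(* Induction on the size of [S :\: A]: moving one of its elements [i] into [A] costs at most [rho
   [set i]], by submodularity for two disjoint sets. *)
have [n] := ubnP #|S :\: A|; elim: n A => // n IH A.
have [/eqP e|[i iS]] := set_0Vmem (S :\: A).
  rewrite (eqP e) /weight big_set0 addr0 => _.
  by move: e; rewrite setD_eq0 => /setUidPl ->.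
rewrite (cardsD1 i) iS add1n ltnS => lt.
have [iA iS'] : i \notin A /\ i \in S by move: iS; rewrite inE => /andP[].
have eD : S :\: (i |: A) = (S :\: A) :\ i by rewrite setDDl setUC.
have -> : A :|: S = i |: A :|: S.
  by rewrite -setUA setUCA (setUidPr (_ : [set i] \subset S)) // sub1set.
have := IH (i |: A); rewrite (weight_diffD1 rho iS) eD => /(_ lt).
have := sub [set i] A.
have -> : [set i] :&: A = set0.
  by apply/eqP; rewrite setI_eq0 disjoints1.
by rewrite r0; lra.
Qed.

Lemma rank_bound_refl (R : realType) (E : finType) (rho : {set E} -> R)
    (A : {set E}) : rank_bound rho A A = rho A.
Proof. by rewrite /rank_bound /weight setDv big_set0 addr0. Qed.

Lemma rho_le_rank_bound (R : realType) (E : finType) (rho : {set E} -> R)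
    (A B : {set E}) :
  polymatroid rho -> rho (A :|: B) <= rank_bound rho A B.
Proof. by move=> hrho; rewrite setUC; apply: rho_leU_weight. Qed.

Lemma rank_bound_ge (R : realType) (E : finType) (rho : {set E} -> R)
    (A B : {set E}) :
  polymatroid rho -> rho A <= rank_bound rho A B.
Proof.
move=> hrho; apply: le_trans (rho_le_rank_bound A B hrho).
by case: hrho => _ mono _; apply: mono; apply: subsetUl.
Qed.

(** Diminishing returns: submodularity for [A :|: [set i]] and [B], which meet in [A]. *)
Lemma rho_marginal_add (R : realType) (E : finType) (rho : {set E} -> R)
    (A B : {set E}) (i : E) :
  polymatroid rho -> A \subset B -> i \notin B ->
  rho (B :|: [set i]) + rho A <= rho (A :|: [set i]) + rho B.
Proof.
move=> [_ _ sub] AB iB; have := sub (A :|: [set i]) B.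
rewrite setUAC (setUidPr AB) setIUl (setIidPl AB).
suff -> : [set i] :&: B = set0 by rewrite setU0.
by apply/eqP; rewrite setI_eq0 disjoints1.
Qed.

(** The deletion form of diminishing returns: submodularity for [C] and [D :\ i], which meet in
    [C :\ i]. *)
Lemma rho_marginal_del (R : realType) (E : finType) (rho : {set E} -> R)
    (C D : {set E}) (i : E) :
  polymatroid rho -> C \subset D -> i \in C ->
  rho D + rho (C :\ i) <= rho C + rho (D :\ i).
Proof.
move=> [_ _ sub] CD iC; have := sub C (D :\ i).
have -> : C :|: D :\ i = D.
  apply/setP=> j; rewrite !inE; have [->|_] := eqVneq j i.
    by rewrite iC (subsetP CD).
  by case: (boolP (j \in C)) => // /(subsetP CD) ->.
by rewrite setIDA (setIidPl CD).
Qed.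

(** * Closure *)

Lemma subset_cl (R : realType) (E : finType) (rho : {set E} -> R)
    (A : {set E}) : A \subset cl rho A.
Proof. by apply/bigcapsP => F /andP[]. Qed.

Lemma cl_min (R : realType) (E : finType) (rho : {set E} -> R)
    (A F : {set E}) : flat rho F -> A \subset F -> cl rho A \subset F.
Proof. by move=> fF AF; apply: (bigcap_min F); rewrite ?fF. Qed.

(** A point outside the intersection misses one of the two flats; it strictly raises the rank there,
    and raises that of the smaller set at least as much. *)
Lemma flat_setI (R : realType) (E : finType) (rho : {set E} -> R)
    (F G : {set E}) :
  polymatroid rho -> flat rho F -> flat rho G -> flat rho (F :&: G).
Proof.
move=> hrho /forallP fF /forallP fG; apply/forallP => i; apply/implyP.
rewrite inE negb_and => /orP[iF|iG].
  have := implyP (fF i) iF.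
  by have := rho_marginal_add hrho (subsetIl F G) iF; lra.
have := implyP (fG i) iG.
by have := rho_marginal_add hrho (subsetIr F G) iG; lra.
Qed.

Lemma flatT (R : realType) (E : finType) (rho : {set E} -> R) :
  flat rho setT.
Proof. by apply/forallP => i; rewrite inE. Qed.

Lemma flat_cl (R : realType) (E : finType) (rho : {set E} -> R)
    (A : {set E}) : polymatroid rho -> flat rho (cl rho A).
Proof.
move=> hrho; rewrite /cl; apply: (big_ind (flat rho)) => [|F G|F /andP[]//].
  exact: flatT.
exact: flat_setI.
Qed.

(** A point of [X] outside the closure would raise the rank of the closure, hence that of [A]; but
    adding it to [A] stays inside [X]. *)
Lemma rho_eq_sub_cl (R : realType) (E : finType) (rho : {set E} -> R)
    (A X : {set E}) :
  polymatroid rho -> A \subset X -> rho X = rho A -> X \subset cl rho A.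
Proof.
move=> hrho AX eX; apply/subsetP => i iX; apply: contraT => iA.
have := implyP (forallP (flat_cl A hrho) i) iA.
have := rho_marginal_add hrho (subset_cl rho A) iA.
suff : rho (A :|: [set i]) <= rho A by lra.
by case: hrho => _ mono _; rewrite -eX mono // subUset AX sub1set.
Qed.

(** A maximal superset of [A] with the rank of [A] is flat, so it contains the closure; monotonicity
    does the rest. *)
Lemma rho_cl (R : realType) (E : finType) (rho : {set E} -> R)
    (A : {set E}) : polymatroid rho -> rho (cl rho A) = rho A.
Proof.
move=> hrho; have [_ mono _] := hrho.
have [X /maxsetP[/andP[AX /eqP eX] maxX] _] :=
  @maxset_exists _ (fun X => (A \subset X) && (rho X == rho A)) A
    (introT andP (conj (subxx A) (eqxx _))).
have fX : flat rho X.
  apply/forallP => i; apply/implyP => iX.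
  rewrite lt_neqAle mono ?subsetUl // andbT; apply: contra iX => /eqP e.
  rewrite -(maxX (X :|: [set i])) ?subsetUl ?inE ?eqxx ?orbT //.
  by rewrite -e eX eqxx (subset_trans AX) ?subsetUl.
apply/eqP; rewrite eq_le (mono _ _ (subset_cl rho A)) andbT -eX.
by apply: mono; apply: cl_min.
Qed.

(** * Cyclic part *)

Lemma cy_subset (R : realType) (E : finType) (rho : {set E} -> R)
    (A : {set E}) : cy rho A \subset A.
Proof. by apply/bigcupsP => C /andP[]. Qed.

Lemma cy_max (R : realType) (E : finType) (rho : {set E} -> R)
    (A C : {set E}) : cyclic_set rho C -> C \subset A -> C \subset cy rho A.
Proof. by move=> cC CA; apply: (bigcup_max C); rewrite ?cC. Qed.

(** Here [D] need not be cyclic. Unions and closures of cyclic sets, and the lower inclusion in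
    (II), rest on this. *)
Lemma cyclic_superset_lt (R : realType) (E : finType) (rho : {set E} -> R)
    (C D : {set E}) (i : E) :
  polymatroid rho -> cyclic_set rho C -> C \subset D -> i \in C ->
  0 < rho [set i] -> rho D < rho (D :\ i) + rho [set i].
Proof.
move=> hrho /forallP cC CD iC i0; have := rho_marginal_del hrho CD iC.
by have := implyP (implyP (cC i) iC) i0; lra.
Qed.

Lemma cyclic_setU (R : realType) (E : finType) (rho : {set E} -> R)
    (C D : {set E}) :
  polymatroid rho -> cyclic_set rho C -> cyclic_set rho D ->
  cyclic_set rho (C :|: D).
Proof.
move=> hrho cC cD; apply/forallP => i; apply/implyP; rewrite inE => iCD.
apply/implyP; case/orP: iCD => iC.
  exact: cyclic_superset_lt hrho cC (subsetUl _ _) iC.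
exact: cyclic_superset_lt hrho cD (subsetUr _ _) iC.
Qed.

Lemma cyclic_set0 (R : realType) (E : finType) (rho : {set E} -> R) :
  cyclic_set rho set0.
Proof. by apply/forallP => i; rewrite inE. Qed.

Lemma cyclic_cy (R : realType) (E : finType) (rho : {set E} -> R)
    (A : {set E}) : polymatroid rho -> cyclic_set rho (cy rho A).
Proof.
move=> hrho; rewrite /cy; apply: (big_ind (cyclic_set rho)) => [|C D|C /andP[]//].
  exact: cyclic_set0.
exact: cyclic_setU.
Qed.

(** A minimal [X] inside [A] with [rank_bound rho A X] equal to [rho A] is cyclic, since deleting an
    element that violates cyclicity would keep the equality. Hence [X] lies in [cy rho A]. *)
Lemma rho_cy (R : realType) (E : finType) (rho : {set E} -> R)
    (A : {set E}) :
  polymatroid rho -> rho A = rho (cy rho A) + weight rho (A :\: cy rho A).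
Proof.
move=> hrho; have [|X /minsetP[/andP[XA /eqP eX] minX] _] :=
  @minset_exists _ (fun X => (X \subset A) && (rho A == rank_bound rho A X)) A.
  by rewrite rank_bound_refl subxx eqxx.
have cX : cyclic_set rho X.
  apply/forallP => i; apply/implyP => iX; apply/implyP => i0.
  rewrite ltNge; apply/negP => le.
  suff e : X :\ i = X by move: iX; rewrite -e !inE eqxx.
  apply: minX; last exact: subD1set.
  rewrite (subset_trans (subD1set _ _) XA) /= eq_le rank_bound_ge //= eX.
  rewrite /rank_bound (@weight_diffD1 _ _ _ A (X :\ i) i).
    by rewrite setD1K //; lra.
  by rewrite !inE eqxx (subsetP XA).
(* Passing from [X] up to [cy rho A] adds at most the weight of the difference, so the bound at
   [cy rho A] is no larger than at [X]. *)
have := rank_bound_ge A (cy rho A) hrho.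
have := rho_leU_weight X (cy rho A) hrho.
rewrite (setUidPr (cy_max cX XA)) => h1 h2; apply/eqP.
rewrite eq_le h2 /= {1}eX /rank_bound.
suff : weight rho (A :\: X) =
       weight rho (cy rho A :\: X) + weight rho (A :\: cy rho A).
  by move=> ->; lra.
rewrite /weight (big_setID (cy rho A)) /=; congr (_ + _); apply: eq_bigl => j.
  rewrite !inE; case: (boolP (j \in cy rho A)) => [/(subsetP (cy_subset _ _))->|].
    by rewrite andbT.
  by rewrite !andbF.
by rewrite !inE; case: (boolP (j \in X)) => [/(subsetP (cy_max cX XA))->|].
Qed.

(** * Cyclic flats *)

Lemma cyclic_cl (R : realType) (E : finType) (rho : {set E} -> R)
    (C : {set E}) :
  polymatroid rho -> cyclic_set rho C -> cyclic_set rho (cl rho C).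
Proof.
move=> hrho cC; apply/forallP => i; apply/implyP => icl; apply/implyP => i0.
have [iC|iC] := boolP (i \in C).
  exact: cyclic_superset_lt hrho cC (subset_cl _ _) iC i0.
(* A point gained by closing can be deleted without loss of rank, as [C] survives. *)
suff : rho (cl rho C) <= rho (cl rho C :\ i) by lra.
rewrite rho_cl //; case: hrho => _ mono _; apply: mono.
by rewrite subsetD1 subset_cl.
Qed.

Lemma flat_cy (R : realType) (E : finType) (rho : {set E} -> R)
    (F : {set E}) :
  polymatroid rho -> flat rho F -> flat rho (cy rho F).
Proof.
move=> hrho fF; apply/forallP => i; apply/implyP => icy.
have [iF|iF] := boolP (i \in F); last first.
  have := implyP (forallP fF i) iF.
  by have := rho_marginal_add hrho (cy_subset rho F) iF; lra.
(* A singleton of rank zero is cyclic, so it would lie in [cy rho F]. *)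
have i0 : 0 < rho [set i].
  rewrite lt_neqAle rho_ge0 // andbT; apply: contra icy => /eqP e.
  rewrite -sub1set; apply: cy_max; last by rewrite sub1set.
  by apply/forallP => j; rewrite inE; apply/implyP=> /eqP ->; rewrite -e ltxx.
(* Comparing this bound with the equality [rho_cy] shows that [i] adds its full rank to
   [cy rho F]. *)
have := rank_bound_ge F (i |: cy rho F) hrho.
rewrite (rho_cy F hrho) (@weight_diffD1 _ _ _ F _ i) ?inE ?icy //.
by rewrite /rank_bound setUC; lra.
Qed.

(** * The rank bound *)

Lemma rank_bound_cl (R : realType) (E : finType) (rho : {set E} -> R)
    (A X : {set E}) :
  polymatroid rho -> rank_bound rho A (cl rho X) <= rank_bound rho A X.
Proof.
move=> hrho; rewrite /rank_bound rho_cl // lerD2l.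
by apply: weight_sub => //; apply: setDS; apply: subset_cl.
Qed.

(** The rank lost is exactly the weight of [X :\: cy rho X], which pays for every element newly left
    uncovered in [A]. *)
Lemma rank_bound_cy (R : realType) (E : finType) (rho : {set E} -> R)
    (A X : {set E}) :
  polymatroid rho -> rank_bound rho A (cy rho X) <= rank_bound rho A X.
Proof.
move=> hrho; rewrite /rank_bound (rho_cy X hrho) -addrA lerD2l.
apply: weight_subU => //; apply/subsetP => j; rewrite !inE.
by case: (j \in X); case: (j \in cy rho X); case: (j \in A).
Qed.

Lemma rank_bound_submod (R : realType) (E : finType) (rho : {set E} -> R)
    (A B B' : {set E}) :
  polymatroid rho ->
  rank_bound rho A (B :|: B') + rank_bound rho A (B :&: B') <=
  rank_bound rho A B + rank_bound rho A B'.
Proof.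
move=> [_ _ sub]; have := sub B B'.
by have := weight_diff_modular rho A B B'; rewrite /rank_bound; lra.
Qed.

Lemma RsetP (R : realType) (E : finType) (rho : {set E} -> R)
    (A B : {set E}) :
  polymatroid rho ->
  reflect [/\ flat rho B, cyclic_set rho B & rank_bound rho A B <= rho A]
          (B \in Rset rho A).
Proof.
move=> hrho; rewrite !inE -/(weight rho _) -/(rank_bound rho A B) eq_le.
by rewrite rank_bound_ge //= -andbA; apply: and3P.
Qed.

Theorem theorem5p17 (R : realType) (E : finType) (rho : {set E} -> R)
    (hrho : polymatroid rho) (A : {set E}) :
  [/\ (* (I) *)
      cl rho (cy rho A) \in Rset rho A /\ cy rho (cl rho A) \in Rset rho A,
      (* (II) *)
      forall B : {set E}, B \in Rset rho A ->
        cl rho (cy rho A) \subset B /\ B \subset cy rho (cl rho A),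
      (* (III) *)
      forall B B' : {set E}, B \in Rset rho A -> B' \in Rset rho A ->
        cy rho (B :&: B') \in Rset rho A /\ cl rho (B :|: B') \in Rset rho A
    & (* (IV) *)
      forall B B' : {set E}, B \in Rset rho A -> B' \in Rset rho A ->
        rho B + rho B' = rho (B :|: B') + rho (B :&: B')].
Proof.
have bcl X := rank_bound_cl A X hrho.
have bcy X := rank_bound_cy A X hrho.
have bge X := rank_bound_ge A X hrho.
split.
- split; apply/(RsetP _ _ hrho); split.
  + exact: flat_cl.
  + exact/cyclic_cl/cyclic_cy.
  + by rewrite -[leRHS]rank_bound_refl (le_trans (bcl _)).
  + exact/flat_cy/flat_cl.
  + exact: cyclic_cy.
  + by rewrite -[leRHS]rank_bound_refl (le_trans (bcy _)).
- move=> B /(RsetP _ _ hrho)[fB cB eB]; have [_ mono _] := hrho; split.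
    (* As [B] is flat, it must only contain [cy rho A]. For [i] in [cy rho A] but not in [B], the
       bound for [A :\ i] at [B] gives that set rank at most [rho A - rho [set i]], against
       cyclicity at [i]. *)
    apply: cl_min => //; apply/subsetP => i icy; apply: contraT => iB.
    have iA := subsetP (cy_subset rho A) i icy.
    have i0 : 0 < rho [set i].
      have := implyP (forallP fB i) iB; have [_ _ sub] := hrho.
      have := sub B [set i]; have := rho_ge0 (B :&: [set i]) hrho; lra.
    have := cyclic_superset_lt hrho (cyclic_cy A hrho) (cy_subset rho A) icy i0.
    have := rank_bound_ge (A :\ i) B hrho.
    have := @weight_diffD1 _ _ rho A B i; rewrite !inE iB iA => /(_ isT).
    by move: eB; rewrite /rank_bound setDDl; lra.
  (* As [B] is cyclic, it need only lie in [cl rho A]; it does because [A :|: B] has the rank of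
     [A]. *)
  apply: cy_max => //; apply: subset_trans (subsetUr A B) _.
  apply: rho_eq_sub_cl => //; first exact: subsetUl.
  apply/eqP; rewrite eq_le (mono _ _ (subsetUl _ _)) andbT.
  exact: le_trans (rho_le_rank_bound A B hrho) eB.
- move=> B B' /(RsetP _ _ hrho)[fB cB eB] /(RsetP _ _ hrho)[fB' cB' eB'].
  have := rank_bound_submod A B B' hrho.
  have := bge (B :|: B'); have := bge (B :&: B') => hI hU hs.
  (* The intersection is flat and the union cyclic, both with bound [rho A]; [cy] and [cl] supply
     the missing property without raising it. *)
  split; apply/(RsetP _ _ hrho); split.
  + exact/flat_cy/flat_setI.
  + exact: cyclic_cy.
  + by apply: le_trans (bcy _) _; lra.
  + exact: flat_cl.
  + exact/cyclic_cl/cyclic_setU.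
  + by apply: le_trans (bcl _) _; lra.
- move=> B B' /(RsetP _ _ hrho)[_ _ eB] /(RsetP _ _ hrho)[_ _ eB'].
  (* All four bounds equal [rho A], and their weight terms cancel by modularity, leaving the
     identity for [rho]. *)
  have := rank_bound_submod A B B' hrho.
  have := bge (B :|: B'); have := bge (B :&: B').
  have := bge B; have := bge B'; have := weight_diff_modular rho A B B'.
  by move: eB eB'; rewrite /rank_bound; lra.
Qed.
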